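(* Let $\mathbb{K}$ be a field. Then $(\mathrm{ParQSym},\star,\Delta,M_\emptyset,\varepsilon)$, with product $\star$, coproduct $\Delta$, unit element $M_\emptyset$ and counit $\varepsilon$, is a bialgebra over $\mathbb{K}$.
   Context: **Partition diagrams.** A partition diagram of order $k\ge 0$ is a set partition of $\{1,\dots,k,1',\dots,k'\}$ ($1,\dots,k$ are the upper nodes, $1',\dots,k'$ the lower nodes); for $k=0$ the only one is the empty diagram $\emptyset$. For $\pi$ of order $k$ and $\rho$ of order $m$, $\pi\otimes\rho$ is the diagram of order $k+m$ whose blocks are the blocks of $\pi$ and the blocks of $\rho$ with labels shifted by $k$ ($i\mapsto i+k$, $i'\mapsto (i+k)'$). If $k,m\ge1$, $\pi\bullet\rho$ is obtained from $\pi\otimes\rho$ by merging the block containing $k'$ with the block containing $(k+1)'$. The empty diagram is the unit for both operations. A diagram is $\otimes$-irreducible if it is not of the form $\rho\otimes\sigma$ with $\rho,\sigma$ both non-empty (so $\emptyset$ is $\otimes$-irreducible). Every non-empty $\pi$ is uniquely $\pi_1\otimes\cdots\otimes\pi_l$ with all $\pi_i$ non-empty and $\otimes$-irreducible. **ParQSym.** $\mathrm{ParQSym}$ is the $\mathbb{K}$-vector space with basis $\{M_\pi\}$ indexed by all partition diagrams $\pi$. Coproduct: $\Delta M_\sigma=\sum_{\pi\otimes\rho=\sigma}M_\pi\otimes M_\rho$, over all ordered pairs of (possibly empty) diagrams with $\pi\otimes\rho=\sigma$. Counit: $\varepsilon(M_\pi)=\delta_{\pi,\emptyset}$. Product: $M_\emptyset$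 is the unit; for non-empty $\rho=\rho_1\otimes\cdots\otimes\rho_n$, $\sigma=\sigma_1\otimes\cdots\otimes\sigma_m$ with all $\rho_i,\sigma_j$ non-empty $\otimes$-irreducible, $$M_\rho\star M_\sigma=\sum M_{(\rho'_1\bullet\sigma'_1)\otimes\cdots\otimes(\rho'_k\bullet\sigma'_k)},$$ over all $k\in\mathbb{N}$ and all pairs of sequences of diagrams $(\rho'_1,\dots,\rho'_k)$, $(\sigma'_1,\dots,\sigma'_k)$ that become $(\rho_1,\dots,\rho_n)$, respectively $(\sigma_1,\dots,\sigma_m)$, after deleting all empty diagrams, and such that $\rho'_s\bullet\sigma'_s\ne\emptyset$ for all $1\le s\le k$. *)

(* Defs.v *)
From HB Require Import structures.
From mathcomp Require Import all_boot all_order all_algebra.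
From mathcomp Require Import finmap.
From mathcomp Require Import monalg.
From mathcomp Require Import zify.

Set Implicit Arguments.
Unset Strict Implicit.
Unset Printing Implicit Defensive.

Import GRing.Theory.

Section PartitionFacts.

Lemma partition_merge (T : finType) (P : {set {set T}}) (x y : T) :
  partition P [set: T] ->
  partition ((pblock P x :|: pblock P y)
             |: (P :\ pblock P x :\ pblock P y)) [set: T].
Proof.
move=> Ppart; have covP := cover_partition Ppart.
have Px : pblock P x \in P by rewrite pblock_mem // covP inE.
have Py : pblock P y \in P by rewrite pblock_mem // covP inE.
set A := pblock P x in Px *; set B := pblock P y in Py *.
have AB0 : A :|: B != set0.
  apply/set0Pn; exists x; rewrite inE mem_pblock covP inE //.
have part' : partition (P :\ A :\ B) (~: (A :|: B)).
  have [eqAB | neqAB] := eqVneq B A.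
    rewrite eqAB setUid setDDl setUid -setTD; exact: partitionD1.
  rewrite setCU -setDE -setTD; apply: partitionD1; first exact: partitionD1.
  by rewrite !inE neqAB Py.
rewrite -(setUCr (A :|: B)); apply: partitionU1 => //.
by rewrite disjoints_subset setCK.
Qed.

Lemma partition_imsetU (A B C : finType) (f : A -> C) (g : B -> C)
    (P : {set {set A}}) (Q : {set {set B}}) :
  injective f -> injective g -> (forall a b, f a <> g b) ->
  (forall c, (exists a, c = f a) \/ (exists b, c = g b)) ->
  partition P [set: A] -> partition Q [set: B] ->
  partition ([set f @: S | S : {set A} in P]
             :|: [set g @: S | S : {set B} in Q]) [set: C].
Proof.
move=> injf injg fg cov Pp Qp; apply/and3P; split.
- rewrite -subTset; apply/subsetP => c _; apply/bigcupP.
  have [[a ->]|[b ->]] := cov c.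
    have aP : a \in cover P by rewrite (cover_partition Pp).
    exists (f @: pblock P a); last by rewrite imset_f ?mem_pblock.
    by rewrite inE imset_f ?pblock_mem.
  have bQ : b \in cover Q by rewrite (cover_partition Qp).
  exists (g @: pblock Q b); last by rewrite imset_f ?mem_pblock.
  by rewrite inE orbC imset_f ?pblock_mem.
- apply/trivIsetP => S S' HS HS'; apply: contraR.
  case/pred0Pn => c /andP[/= cS cS']; apply/eqP; move: HS HS' cS cS'.
  rewrite !inE => /orP[] /imsetP[U UP ->] /orP[] /imsetP[V VP ->].
  + move=> /imsetP[a aU ->] /imsetP[a' aV /injf eqa]; subst a'.
    rewrite -(def_pblock (partition_trivIset Pp) UP aU).
    by rewrite -(def_pblock (partition_trivIset Pp) VP aV).
  + by move=> /imsetP[a aU ->] /imsetP[b bV /fg].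
  + by move=> /imsetP[a aU ->] /imsetP[b bV /esym /fg].
  + move=> /imsetP[a aU ->] /imsetP[a' aV /injg eqa]; subst a'.
    rewrite -(def_pblock (partition_trivIset Qp) UP aU).
    by rewrite -(def_pblock (partition_trivIset Qp) VP aV).
- rewrite inE negb_or; apply/andP; split; apply/imsetP => -[S SP /esym/eqP].
    by rewrite imset_eq0 (negPf (partition_neq0 Pp SP)).
  by rewrite imset_eq0 (negPf (partition_neq0 Qp SP)).
Qed.

End PartitionFacts.

(* The upper nodes 1, ..., k are inl 0, ..., inl (k-1); the lower nodes
   1', ..., k' are inr 0, ..., inr (k-1). *)
Notation node k := ('I_k + 'I_k)%type.

Definition pdiag (k : nat) :=
  {P : {set {set node k}} | partition P [set: node k]}.

HB.instance Definition _ k := Finite.on (pdiag k).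

Definition mkpdiag k (P : {set {set node k}})
    (Ppart : partition P [set: node k]) : pdiag k :=
  exist (fun P => is_true (partition P [set: node k])) P Ppart.

Definition diagram := {k : nat & pdiag k}.

HB.instance Definition _ := Choice.on diagram.

Definition mkdiag k (d : pdiag k) : diagram := existT pdiag k d.

Definition order (d : diagram) : nat := tag d.

Lemma empty_subproof : partition set0 [set: node 0].
Proof.
have -> : [set: node 0] = set0 by apply/setP => -[[]|[]].
by rewrite partition_set0.
Qed.

Definition dempty : diagram := mkdiag (mkpdiag empty_subproof).

Definition nodel k m (x : node k) : node (k + m) :=
  match x with inl i => inl (lshift m i) | inr i => inr (lshift m i) end.

Definition noder k m (x : node m) : node (k + m) :=
  match x with inl i => inl (rshift k i) | inr i => inr (rshift k i) end.

Lemma nodel_inj k m : injective (@nodel k m).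
Proof. by move=> [i|i] [j|j] //= [] /val_inj ->. Qed.

Lemma noder_inj k m : injective (@noder k m).
Proof. by move=> [i|i] [j|j] //= [] /addnI /val_inj ->. Qed.

Lemma tensor_subproof k m (P : pdiag k) (Q : pdiag m) :
  partition ([set @nodel k m @: B | B : {set node k} in sval P]
             :|: [set @noder k m @: B | B : {set node m} in sval Q]) [set: node (k + m)].
Proof.
apply: partition_imsetU (svalP P) (svalP Q).
- exact: nodel_inj.
- exact: noder_inj.
- move=> [i|i] [j|j] //= [] E; have := ltn_ord i; rewrite E ltnNge leq_addr //.
- by case=> c; case: (split_ordP c) => i ->;
  [left; exists (inl i)|right; exists (inl i)
  |left; exists (inr i)|right; exists (inr i)].
Qed.

Definition ptensor k m (P : pdiag k) (Q : pdiag m) : pdiag (k + m) :=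
  mkpdiag (tensor_subproof P Q).

Definition pmerge k (P : pdiag k) (x y : node k) : pdiag k :=
  mkpdiag (partition_merge x y (svalP P)).

Definition dtensor (d e : diagram) : diagram :=
  mkdiag (ptensor (tagged d) (tagged e)).

Definition dbullet (d e : diagram) : diagram :=
  (* dempty is the only diagram of order 0, see order_eq0. *)
  match d, e with
  | existT 0 _, _ => e
  | _, existT 0 _ => d
  | existT k.+1 P, existT m.+1 Q =>
      mkdiag (pmerge (ptensor P Q)
                (inr (lshift m.+1 ord_max)) (inr (rshift k.+1 ord0)))
  end.

Definition dtensors (s : seq diagram) : diagram := foldr dtensor dempty s.

Lemma order_tensor d e : order (dtensor d e) = order d + order e.
Proof. by []. Qed.

Lemma order_eq0 d : (order d == 0) = (d == dempty).
Proof.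
apply/eqP/eqP => [|-> //]; case: d => k P; rewrite /order /= => k0; subst k.
congr existT; apply: val_inj => /=; apply/eqP; rewrite -partition_set0.
have <- : [set: node 0] = set0 by apply/setP => -[[]|[]].
exact: (svalP P).
Qed.

Definition diagrams_of_order (k : nat) : seq diagram :=
  [seq mkdiag P | P <- enum {: pdiag k}].

Lemma mem_diagrams_of_order k d : (d \in diagrams_of_order k) = (order d == k).
Proof.
apply/mapP/eqP => [[P _ ->] //|<-].
by exists (tagged d); rewrite ?mem_enum //; case: d.
Qed.

Definition diagram_pairs (n : nat) : seq (diagram * diagram) :=
  flatten [seq [seq (d, e) | d <- diagrams_of_order i,
                             e <- diagrams_of_order (n - i)]
          | i <- iota 0 n.+1].

Lemma mem_diagram_pairs n p :
  (p \in diagram_pairs n) = (order p.1 + order p.2 == n).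
Proof.
apply/flatten_mapP/eqP => [[i] | <-].
  rewrite mem_iota add0n ltnS => /andP[_ le_in] /allpairsP[[d e] /= []].
  rewrite !mem_diagrams_of_order => /eqP Hd /eqP He -> /=.
  by rewrite Hd He subnKC.
exists (order p.1); first by rewrite mem_iota add0n ltnS leq_addr.
apply/allpairsP; exists p.
by rewrite !mem_diagrams_of_order addKn !eqxx; case: p.
Qed.

(* The finite set of all ordered pairs (d, e) such that the tensor product of
   d and e is s, see in_splits. *)
Definition splits (s : diagram) : {fset diagram * diagram} :=
  [fset p in [seq p <- diagram_pairs (order s) | dtensor p.1 p.2 == s]]%fset.

Lemma in_splits s p : (p \in splits s) = (dtensor p.1 p.2 == s).
Proof.
rewrite /splits in_fset -[LHS]/(p \in filter _ _) mem_filter; case: eqP => //= <-.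
by rewrite mem_diagram_pairs order_tensor eqxx.
Qed.

Definition irreducible (s : diagram) : bool :=
  [forall p : splits s, ((val p).1 == dempty) || ((val p).2 == dempty)].

Lemma irreducibleP s :
  reflect (forall d e, dtensor d e = s -> d = dempty \/ e = dempty)
          (irreducible s).
Proof.
apply: (iffP forallP) => [H d e Hde | H [[d e] Hp]] /=.
  have Hp : (d, e) \in splits s by rewrite in_splits Hde.
  by have /= /orP[/eqP ->|/eqP ->] := H [` Hp]%fset; [left | right].
have /eqP /= := etrans (esym (in_splits _ _)) Hp.
by case/H => ->; rewrite eqxx ?orbT.
Qed.

Definition cast_node k m (e : k = m) (x : node k) : node m :=
  match x with inl i => inl (cast_ord e i) | inr i => inr (cast_ord e i) end.

Lemma eq_mkdiag k m (e : k = m) (P : pdiag k) (Q : pdiag m) :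
  [set cast_node e @: B | B : {set node k} in sval P] = sval Q ->
  mkdiag P = mkdiag Q.
Proof.
subst m => E; congr existT; apply: val_inj; rewrite /= -E.
have id_cast : cast_node (erefl k) =1 id by case=> i /=; rewrite cast_ord_id.
rewrite (eq_imset (g := id)) ?imset_id // => B.
by rewrite (eq_imset _ id_cast) imset_id.
Qed.

Lemma dtensorA : associative dtensor.
Proof.
move=> [k P] [m Q] [n R].
apply: (eq_mkdiag (e := addnA k m n)) => /=.
have imset_comp2 (A B C : finType) (f : A -> B) (g : B -> C)
    (S : {set {set A}}) :
    [set g @: T | T : {set B} in [set f @: T | T : {set A} in S]]
    = [set (g \o f) @: T | T : {set A} in S].
  by rewrite -imset_comp; apply: eq_imset => T /=; rewrite -imset_comp.
have imset_eq2 (A B : finType) (f g : A -> B) (S : {set {set A}}) : f =1 g ->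
    [set f @: T | T : {set A} in S] = [set g @: T | T : {set A} in S].
  by move=> fg; apply: eq_imset => T; apply: eq_imset.
rewrite !imsetU !imset_comp2 setUA; congr (_ :|: _ :|: _); apply: imset_eq2.
- by case=> i /=; [congr inl | congr inr]; apply: val_inj.
- by case=> i /=; [congr inl | congr inr]; apply: val_inj.
- by case=> i /=; [congr inl | congr inr]; apply: val_inj; rewrite /= addnA.
Qed.

Lemma dempty_tensor : left_id dempty dtensor.
Proof.
move=> [k P]; apply: (eq_mkdiag (e := erefl k)) => /=.
rewrite imset0 set0U -imset_comp -[RHS]imset_id; apply: eq_imset => B /=.
rewrite -imset_comp -[RHS]imset_id; apply: eq_imset.
by case=> i /=; [congr inl | congr inr]; apply: val_inj.
Qed.

Lemma dtensor_empty : right_id dempty dtensor.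
Proof.
move=> [k P]; apply: (eq_mkdiag (e := addn0 k)) => /=.
rewrite imset0 setU0 -imset_comp -[RHS]imset_id; apply: eq_imset => B /=.
rewrite -imset_comp -[RHS]imset_id; apply: eq_imset.
by case=> i /=; [congr inl | congr inr]; apply: val_inj.
Qed.

Lemma dtensors_cat s t :
  dtensors (s ++ t) = dtensor (dtensors s) (dtensors t).
Proof.
by elim: s => [|d s IHs] /=; rewrite ?dempty_tensor // -dtensorA -IHs.
Qed.

Lemma dtensor_factor_subproof d :
  exists s, all (fun e => (e != dempty) && irreducible e) s
            && (dtensors s == d).
Proof.
have [n] := ubnP (order d); elim: n d => // n IHn d; rewrite ltnS => ledn.
have [->|d0] := eqVneq d dempty; first by exists [::]; rewrite /= eqxx.
have [irr|] := boolP (irreducible d).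
  by exists [:: d]; rewrite /= d0 irr dtensor_empty eqxx.
rewrite negb_forall => /existsP[[[a b] /= ab]]; rewrite negb_or.
move: ab; rewrite in_splits /= => /eqP Hab /andP[].
rewrite -!order_eq0 -!lt0n => a0 b0.
have Hd : order d = order a + order b by rewrite -Hab order_tensor.
have [|sa /andP[alla /eqP sa_eq]] := IHn a.
  by apply: leq_trans ledn; rewrite Hd -[X in X < _]addn0 ltn_add2l.
have [|sb /andP[allb /eqP sb_eq]] := IHn b.
  by apply: leq_trans ledn; rewrite Hd -[X in X < _]add0n ltn_add2r.
by exists (sa ++ sb); rewrite all_cat alla allb dtensors_cat sa_eq sb_eq Hab /=.
Qed.

(* The decomposition of d into non-empty irreducible factors; it is unique, so
   the choice made by xchoose is immaterial. *)
Definition factors (d : diagram) : seq diagram :=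
  xchoose (dtensor_factor_subproof d).

Lemma factorsP d :
  all (fun e => (e != dempty) && irreducible e) (factors d)
  && (dtensors (factors d) == d).
Proof. exact: (xchooseP (dtensor_factor_subproof d)). Qed.

Definition dbullets (p : seq diagram * seq diagram) : seq diagram :=
  [seq dbullet x.1 x.2 | x <- zip p.1 p.2].

Definition is_shuffle (r s : seq diagram) (p : seq diagram * seq diagram) :=
  [&& size p.1 == size p.2,
      [seq d <- p.1 | d != dempty] == r,
      [seq d <- p.2 | d != dempty] == s
    & all (fun d => d != dempty) (dbullets p)].

Definition words (A : seq diagram) (k : nat) : seq (seq diagram) :=
  iter k (fun S => [seq d :: s | d <- A, s <- S]) [:: [::]].

Lemma mem_words A k w : (w \in words A k) = (size w == k) && all (mem A) w.
Proof.
elim: k w => [|k IHk] [|d w] //=.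
  by apply/allpairsP => -[[? ?] /= []].
rewrite eqSS andbCA -IHk; apply/allpairsP/andP => [[[e v] /= [? ?]] [-> ->] //|].
by case=> Ad wk; exists (d, w).
Qed.

Definition word_pairs (A B : seq diagram) (n : nat) :=
  flatten [seq [seq (r, s) | r <- words A k, s <- words B k]
          | k <- iota 0 n.+1].

Lemma mem_word_pairs A B n p : size p.1 = size p.2 -> size p.1 <= n ->
  all (mem A) p.1 -> all (mem B) p.2 -> p \in word_pairs A B n.
Proof.
case: p => r s rs rn Ar Bs; apply/flatten_mapP; exists (size r).
  by rewrite mem_iota add0n ltnS.
by apply/allpairsP; exists (r, s); rewrite !mem_words -rs eqxx Ar Bs.
Qed.

(* The finite set of all pairs of sequences satisfying is_shuffle, see
   in_shuffles. *)
Definition shuffles (r s : seq diagram) : {fset seq diagram * seq diagram} :=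
  [fset p in [seq p <- word_pairs (dempty :: r) (dempty :: s)
                         (size r + size s)
             | is_shuffle r s p]]%fset.

Lemma in_shuffles r s p : (p \in shuffles r s) = is_shuffle r s p.
Proof.
rewrite /shuffles in_fset -[LHS]/(p \in filter _ _) mem_filter; apply: andb_idr.
case: p => r' s' /and4P[/= /eqP szE /eqP rE /eqP sE Hall].
have memE t u : [seq d <- t | d != dempty] = u -> all (mem (dempty :: u)) t.
  move=> <-; apply/allP => d dt; rewrite /= inE mem_filter dt andbT.
  by case: (d == dempty).
apply: mem_word_pairs => //=; [|exact: memE|exact: memE].
rewrite -rE -sE !size_filter.
elim: r' s' szE Hall {rE sE} => [|d r' IH] [|e s'] //= [szE].
rewrite /dbullets /= => /andP[de] /(IH _ szE).
have : (d != dempty) || (e != dempty).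
  by apply: contraR de; rewrite negb_or !negbK => /andP[/eqP -> /eqP ->].
by case: (d != _); case: (e != _) => //= _ ?; lia.
Qed.

Section FreeModules.

Context (K : fieldType).
Local Open Scope ring_scope.

Implicit Types (X Y Z : choiceType).

(* The linear map sending the basis vector << x >> to f x. *)
Definition lext X (U : lmodType K) (f : X -> U) (u : {malg K[X]}) : U :=
  \sum_(x <- msupp u) u@_x *: f x.

(* The tensor product of the free modules on X and Y, modelled by the free
   module on X * Y; see tens_universal. *)
Definition tens X Y (u : {malg K[X]}) (v : {malg K[Y]}) : {malg K[(X * Y)%type]} :=
  lext (fun x => lext (fun y => << (x, y) >>) v) u.

Definition tmap X Y X' Y' (f : {malg K[X]} -> {malg K[X']})
    (g : {malg K[Y]} -> {malg K[Y']}) : {malg K[(X * Y)%type]} -> {malg K[(X' * Y')%type]} :=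
  lext (fun p => tens (f << p.1 >>) (g << p.2 >>)).

Definition tassoc X Y Z : {malg K[((X * Y) * Z)%type]} -> {malg K[(X * (Y * Z))%type]} :=
  lext (fun p => << (p.1.1, (p.1.2, p.2)) >>).

(* f (x) id and id (x) f followed by the identifications of K (x) V and
   V (x) K with V. *)
Definition tscall X Y (f : {malg K[X]} -> K) : {malg K[(X * Y)%type]} -> {malg K[Y]} :=
  lext (fun p => f << p.1 >> *: << p.2 >>).

Definition tscalr X Y (f : {malg K[Y]} -> K) : {malg K[(X * Y)%type]} -> {malg K[X]} :=
  lext (fun p => f << p.2 >> *: << p.1 >>).

(* The product of the tensor square: (a (x) b) (c (x) d) = a c (x) b d. *)
Definition tmul X (m : {malg K[X]} -> {malg K[X]} -> {malg K[X]})
    (u v : {malg K[(X * X)%type]}) : {malg K[(X * X)%type]} :=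
  lext (fun p => lext (fun q =>
    tens (m << p.1 >> << q.1 >>) (m << p.2 >> << q.2 >>)) v) u.

Definition bilinear (U V W : lmodType K) (b : U -> V -> W) :=
  (forall v, linear (b ^~ v)) /\ (forall u, linear (b u)).

Lemma lext_linear X (U : lmodType K) (f : X -> U) : linear (lext f).
Proof.
have lextEw (d : {fset X}) u : (msupp u `<=` d)%fset ->
    lext f u = \sum_(x <- d) u@_x *: f x.
  move=> le; apply: big_fset_incl => // x _ /mcoeff_outdom ->.
  by rewrite scale0r.
move=> a u v; pose d := (msupp u `|` msupp v)%fset.
rewrite (lextEw d u) ?(lextEw d v) ?fsubsetUl ?fsubsetUr //.
rewrite (lextEw d); last first.
  apply: (fsubset_trans (msuppD_le _ _)); apply: fsetSU; exact: msuppZ_le.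
rewrite scaler_sumr -big_split; apply: eq_bigr => x _ /=.
by rewrite mcoeffD mcoeffZ scalerDl scalerA.
Qed.

Lemma lextU X (U : lmodType K) (f : X -> U) x : lext f << x >> = f x.
Proof. by rewrite /lext msuppU oner_eq0 big_seq_fset1 mcoeffUU scale1r. Qed.

Lemma malg_basisE X (u : {malg K[X]}) :
  u = \sum_(x <- msupp u) u@_x *: << x >>.
Proof.
rewrite {1}(monalgE u); apply: eq_bigr => x _; apply/malgP => y.
by rewrite mcoeffZ !mcoeffU mulrnAr mulr1.
Qed.

Lemma lext_unique X (U : lmodType K) (f : X -> U) (g : {malg K[X]} -> U) :
  linear g -> (forall x, g << x >> = f x) -> g =1 lext f.
Proof.
move=> lg gf u; have g0 : g 0 = 0.
  by rewrite -[X in g X](addNr 0) -scaleN1r lg scaleN1r addNr.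
rewrite /lext [X in g X]malg_basisE; elim: (enum_fset _) => [|x s IHs].
  by rewrite !big_nil.
by rewrite !big_cons lg IHs gf.
Qed.

Lemma eq_lext X (U : lmodType K) (f g : X -> U) : f =1 g -> lext f =1 lext g.
Proof. by move=> fg u; apply: eq_bigr => x _; rewrite fg. Qed.

Lemma lextD X (U : lmodType K) a (f g : X -> U) u :
  lext (fun x => a *: f x + g x) u = a *: lext f u + lext g u.
Proof.
rewrite /lext scaler_sumr -big_split; apply: eq_bigr => x _ /=.
by rewrite scalerDr !scalerA mulrC.
Qed.

Lemma tensU X Y (x : X) (y : Y) : tens << x >> << y >> = << (x, y) >>.
Proof. by rewrite /tens !lextU. Qed.

Lemma tens_bilinear X Y : bilinear (@tens X Y).
Proof.
split=> [v a u u' | u a v v']; first exact: lext_linear.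
rewrite /tens -lextD; apply: eq_lext => x; exact: lext_linear.
Qed.

Lemma eq_bilinear X Y (U : lmodType K) (b c : {malg K[X]} -> {malg K[Y]} -> U) :
  bilinear b -> bilinear c ->
  (forall x y, b << x >> << y >> = c << x >> << y >>) ->
  forall u v, b u v = c u v.
Proof.
move=> [b1 b2] [c1 c2] bc u v.
rewrite (lext_unique (b1 v) (fun=> erefl)) (lext_unique (c1 v) (fun=> erefl)).
apply: eq_lext => x.
rewrite (lext_unique (b2 _) (fun=> erefl)) (lext_unique (c2 _) (fun=> erefl)).
by apply: eq_lext => y.
Qed.

Lemma tens_universal X Y (U : lmodType K)
    (b : {malg K[X]} -> {malg K[Y]} -> U) : bilinear b ->
  exists f : {malg K[(X * Y)%type]} -> U,
    [/\ linear f, forall u v, f (tens u v) = b u v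
      & forall g : {malg K[(X * Y)%type]} -> U, linear g ->
          (forall u v, g (tens u v) = b u v) -> g =1 f].
Proof.
move=> bb; exists (lext (fun p => b << p.1 >> << p.2 >>)); split.
- exact: lext_linear.
- apply: eq_bilinear => // [|x y]; last by rewrite tensU lextU.
  have [t1 t2] := tens_bilinear X Y.
  by split=> [v a u u' | u a v v']; rewrite (t1, t2) lext_linear.
- move=> g lg gb; apply: lext_unique => // -[x y] /=.
  by rewrite -gb tensU.
Qed.

Lemma tmap_tens X Y X' Y' (f : {malg K[X]} -> {malg K[X']})
    (g : {malg K[Y]} -> {malg K[Y']}) u v : linear f -> linear g ->
  tmap f g (tens u v) = tens (f u) (g v).
Proof.
move=> lf lg; have [t1 t2] := tens_bilinear X Y.
have [t1' t2'] := tens_bilinear X' Y'; move: u v.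
apply: (@eq_bilinear _ _ _ (fun u v => tmap f g (tens u v))
                           (fun u v => tens (f u) (g v))).
- by split=> [v a u u' | u a v v']; rewrite (t1, t2) /tmap lext_linear.
- by split=> [v a u u' | u a v v']; rewrite (lf, lg) (t1', t2').
- by move=> x y; rewrite tensU /tmap lextU.
Qed.

Lemma tmul_tens X (m : {malg K[X]} -> {malg K[X]} -> {malg K[X]}) a b c d :
  bilinear m -> tmul m (tens a b) (tens c d) = tens (m a c) (m b d).
Proof.
move=> [m1 m2]; have [t1 t2] := tens_bilinear X X.
have L1 v : linear (fun u => tmul m u v) by exact: lext_linear.
have L2 u : linear (tmul m u).
  by move=> k v v'; rewrite /tmul -lextD; apply: eq_lext => p; exact: lext_linear.
move: c d; apply: (@eq_bilinear _ _ _ (fun c d => tmul m (tens a b) (tens c d))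
                     (fun c d => tens (m a c) (m b d))).
- by split=> [v k u u' | u k v v']; rewrite (t1, t2) L2.
- by split=> [v k u u' | u k v v']; rewrite m2 (t1, t2).
move=> x y; move: a b.
apply: (@eq_bilinear _ _ _ (fun a b => tmul m (tens a b) (tens << x >> << y >>))
                     (fun a b => tens (m a << x >>) (m b << y >>))).
- by split=> [v k u u' | u k v v']; rewrite (t1, t2) L1.
- by split=> [v k u u' | u k v v']; rewrite m1 (t1, t2).
by move=> x' y'; rewrite !tensU /tmul !lextU.
Qed.

(* A bialgebra on the K-vector space with basis X. *)
Record is_bialgebra X (m : {malg K[X]} -> {malg K[X]} -> {malg K[X]})
    (one : {malg K[X]}) (delta : {malg K[X]} -> {malg K[(X * X)%type]})
    (eps : {malg K[X]} -> K) : Prop := IsBialgebra {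
  bialg_mul_bilinear : bilinear m;
  bialg_mulA : associative m;
  bialg_1mul : left_id one m;
  bialg_mul1 : right_id one m;
  bialg_comul_linear : linear delta;
  bialg_counit_linear : scalar eps;
  bialg_comulA : forall u,
    tassoc (tmap delta id (delta u)) = tmap id delta (delta u);
  bialg_counitl : forall u, tscall eps (delta u) = u;
  bialg_counitr : forall u, tscalr eps (delta u) = u;
  bialg_comulM : forall u v, delta (m u v) = tmul m (delta u) (delta v);
  bialg_comul1 : delta one = tens one one;
  bialg_counitM : forall u v, eps (m u v) = eps u * eps v;
  bialg_counit1 : eps one = 1
}.

End FreeModules.

Notation ParQSym K := {malg K[diagram]}.

Section ParQSym.

Context (K : fieldType).
Local Open Scope ring_scope.

Definition M (d : diagram) : ParQSym K := << d >>.

(* The product M_d * M_e of two basis vectors. *)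
Definition mulM (d e : diagram) : ParQSym K :=
  if d == dempty then M e else if e == dempty then M d else
  \sum_(p <- shuffles (factors d) (factors e)) M (dtensors (dbullets p)).

Definition PQmul (u v : ParQSym K) : ParQSym K :=
  lext (fun d => lext (mulM d) v) u.

Definition PQcomul : ParQSym K -> {malg K[(diagram * diagram)%type]} :=
  lext (fun d => \sum_(p <- splits d) tens (M p.1) (M p.2)).

Definition PQcounit : ParQSym K -> K :=
  lext (fun d => (d == dempty)%:R : K^o).

End ParQSym.

(* Main.v *)
Require Import Defs.
From HB Require Import structures.
From mathcomp Require Import all_boot all_order all_algebra.
From mathcomp Require Import finmap.
From mathcomp Require Import monalg.
From mathcomp Require Import zify.

(* ParQSym is a quasi-shuffle bialgebra on words. The tensor monoid of diagrams
   is equidivisible, so every diagram is a unique word in the non-empty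
   irreducible diagrams; under this identification Delta is deconcatenation.
   The bullet operation is associative (merging blocks commutes) and preserves
   the alphabet: every proper cut of the bullet of two irreducible diagrams is
   crossed by a block of one of them, or by the merged block. Hence the product
   is the quasi-shuffle product
     (a r) * (b s) = a (r * (b s)) + b ((a r) * s) + (a.b) (r * s),
   where a.b is the bullet of a and b, and associativity and compatibility with
   deconcatenation follow from this recursion by induction on the words. *)

Set Implicit Arguments.
Unset Strict Implicit.
Unset Printing Implicit Defensive.

Import GRing.Theory.

(** * The monoid of diagrams *)

(** Nodes of diagrams whose orders are only provably equal have different types. [side] and [idx]
    determine a node without mentioning the order, so they compare nodes across such types without
    casts. *)
Definition side k (x : node k) : bool := if x is inl _ then true else false.

Definition idx k (x : node k) : nat :=
  match x with inl i => val i | inr i => val i end.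

Lemma node_inj k (x y : node k) : side x = side y -> idx x = idx y -> x = y.
Proof. by case: x => i; case: y => j //= _ /val_inj ->. Qed.

Lemma nodeP k m (z : node (k + m)) :
  (exists x, z = nodel m x) \/ (exists x, z = noder k x).
Proof.
by case: z => c; case: (split_ordP c) => i ->;
  [left; exists (inl i)|right; exists (inl i)
  |left; exists (inr i)|right; exists (inr i)].
Qed.

Lemma nodel_noder k m (x : node k) (y : node m) : nodel m x <> noder k y.
Proof.
case: x => i; case: y => j // -[] E.
  by have := ltn_ord i; rewrite E ltnNge leq_addr.
by have := ltn_ord i; rewrite E ltnNge leq_addr.
Qed.

Lemma idx_nodel k m (x : node k) : idx (nodel m x) = idx x.
Proof. by case: x. Qed.
Lemma idx_noder k m (x : node m) : idx (noder k x) = k + idx x.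
Proof. by case: x. Qed.
Lemma side_nodel k m (x : node k) : side (nodel m x) = side x.
Proof. by case: x. Qed.
Lemma side_noder k m (x : node m) : side (noder k x) = side x.
Proof. by case: x. Qed.
Definition nodeE := (idx_nodel, idx_noder, side_nodel, side_noder).

Lemma idx_lt k (x : node k) : idx x < k.
Proof. by case: x => i /=. Qed.

(** * Diagrams as equivalence relations on nodes *)

Definition psame k (P : pdiag k) (x y : node k) : bool :=
  pblock (sval P) x == pblock (sval P) y.

Lemma psamexx k (P : pdiag k) x : psame P x x.
Proof. exact: eqxx. Qed.

Lemma psameC k (P : pdiag k) x y : psame P x y = psame P y x.
Proof. exact: eq_sym. Qed.

Lemma psame_trans k (P : pdiag k) : transitive (psame P).
Proof. by move=> y x z /eqP xy /eqP yz; rewrite /psame xy yz. Qed.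

Lemma psameP k (P : pdiag k) x y :
  reflect (exists2 B, B \in sval P & x \in B /\ y \in B) (psame P x y).
Proof.
have Pp := svalP P; have tP := partition_trivIset Pp.
have cov z : z \in cover (sval P) by rewrite (cover_partition Pp).
apply: (iffP eqP) => [xy | [B PB [xB yB]]].
  exists (pblock (sval P) x); first exact: pblock_mem.
  by split; [|rewrite xy]; rewrite mem_pblock.
by rewrite (def_pblock tP PB xB) (def_pblock tP PB yB).
Qed.

(** Each block is the class of any of its elements, so the relation determines the blocks.
    Equalities of diagrams are proved this way from here on. *)
Lemma pdiag_ext k (P Q : pdiag k) : psame P =2 psame Q -> P = Q.
Proof.
have sub (S T : pdiag k) : psame S =2 psame T -> sval S \subset sval T.
  move=> eST; have tS := partition_trivIset (svalP S).
  have tT := partition_trivIset (svalP T).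
  have covS z : z \in cover (sval S) by rewrite (cover_partition (svalP S)).
  have covT z : z \in cover (sval T) by rewrite (cover_partition (svalP T)).
  apply/subsetP => B SB.
  have /set0Pn[x xB] := partition_neq0 (svalP S) SB.
  suff <- : pblock (sval T) x = B by rewrite pblock_mem.
  rewrite -(def_pblock tS SB xB); apply/setP => y.
  by rewrite -!eq_pblock //; have /esym := eST x y.
by move=> eq; apply: val_inj; apply/eqP; rewrite eqEsubset !sub //.
Qed.

Lemma mkdiag_inj k : injective (@mkdiag k).
Proof. by move=> P Q; apply: eq_from_Tagged. Qed.

Lemma psame_cast k m (P : pdiag k) (Q : pdiag m) x y x' y' :
  mkdiag P = mkdiag Q -> side x = side x' -> idx x = idx x' ->
  side y = side y' -> idx y = idx y' -> psame P x y = psame Q x' y'.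
Proof.
move=> E; have km : k = m by have := congr1 Defs.order E.
subst m; rewrite (mkdiag_inj E) => sx ix sy iy.
by rewrite (node_inj sx ix) (node_inj sy iy).
Qed.

Lemma pmerge_cast k m (P : pdiag k) (Q : pdiag m) x y x' y' :
  mkdiag P = mkdiag Q -> side x = side x' -> idx x = idx x' ->
  side y = side y' -> idx y = idx y' ->
  mkdiag (pmerge P x y) = mkdiag (pmerge Q x' y').
Proof.
move=> E; have km : k = m by have := congr1 Defs.order E.
subst m; rewrite (mkdiag_inj E) => sx ix sy iy.
by rewrite (node_inj sx ix) (node_inj sy iy).
Qed.

Section Tensor.
Context (k m : nat) (P : pdiag k) (Q : pdiag m).

Lemma psame_tensor_ll x y :
  psame (ptensor P Q) (nodel m x) (nodel m y) = psame P x y.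
Proof.
apply/psameP/psameP => /= [[B] | [B PB [xB yB]]].
  case/setUP => /imsetP[C CP ->] [].
    by rewrite !mem_imset; [exists C | exact: nodel_inj..].
  by case/imsetP => z _ /nodel_noder.
exists (@nodel k m @: B); last by rewrite !imset_f.
by rewrite inE imset_f.
Qed.

Lemma psame_tensor_rr x y :
  psame (ptensor P Q) (noder k x) (noder k y) = psame Q x y.
Proof.
apply/psameP/psameP => /= [[B] | [B PB [xB yB]]].
  case/setUP => /imsetP[C CP ->] [].
    by case/imsetP => z _ /esym/nodel_noder.
  by rewrite !mem_imset; [exists C | exact: noder_inj..].
exists (@noder k m @: B); last by rewrite !imset_f.
by rewrite inE orbC imset_f.
Qed.

Lemma psame_tensor_lr x y : psame (ptensor P Q) (nodel m x) (noder k y) = false.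
Proof.
apply/psameP => /= -[B] /setUP[] /imsetP[C CP ->] [].
  by move=> _ /imsetP[z _ /esym/nodel_noder].
by case/imsetP => z _ /nodel_noder.
Qed.

Lemma psame_tensor_rl x y : psame (ptensor P Q) (noder k y) (nodel m x) = false.
Proof. by rewrite psameC psame_tensor_lr. Qed.

Definition psame_tensor :=
  (psame_tensor_ll, psame_tensor_rr, psame_tensor_lr, psame_tensor_rl).

End Tensor.

Lemma psame_merge k (P : pdiag k) a b x y :
  psame (pmerge P a b) x y =
  [|| psame P x y, psame P x a && psame P b y | psame P x b && psame P a y].
Proof.
have Pp := svalP P; have tP := partition_trivIset Pp.
have cov z : z \in cover (sval P) by rewrite (cover_partition Pp).
have memE z t : (z \in pblock (sval P) t) = psame P z t.
  by rewrite -eq_pblock // eq_sym.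
apply/psameP/idP => /= [[B] | ].
  rewrite 2!inE !in_setD1 => /orP[/eqP -> | /and3P[_ _ PB]].
    rewrite !inE !memE (psameC P a y) (psameC P b y).
    by case=> /orP[] xa /orP[] yb; rewrite ?xa ?yb ?orbT //;
       rewrite (psame_trans xa) // psameC.
  by case=> xB yB; apply/orP; left; apply/psameP; exists B.
have merged : (psame P x a || psame P x b) && (psame P y a || psame P y b) ->
    exists2 B, B \in (pblock (sval P) a :|: pblock (sval P) b)
             |: ((sval P) :\ pblock (sval P) a :\ pblock (sval P) b)
      & x \in B /\ y \in B.
  move=> xy; exists (pblock (sval P) a :|: pblock (sval P) b).
    exact: setU11.
  by rewrite !inE !memE; case/andP: xy.
case/or3P => [xy | /andP[xa yb] | /andP[xb ya]].
(* Nodes related in [P] may already lie in one of the two merged blocks, whose union is then the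
   witness; otherwise their block survives unchanged. *)
- have [xa|/norP[nxa nxb]] := boolP (psame P x a || psame P x b).
    apply: merged; rewrite xa /=.
    by case/orP: xa => xa; rewrite (psame_trans _ xa) ?orbT // psameC.
  exists (pblock (sval P) x); last by rewrite !memE psamexx psameC xy.
  by rewrite inE orbC !in_setD1 pblock_mem // nxa nxb.
- by rewrite psameC in yb; apply: merged; rewrite xa yb orbT.
- by rewrite psameC in ya; apply: merged; rewrite xb ya orbT.
Qed.

Lemma preim_subproof k m (P : pdiag k) (f : node m -> node k) :
  partition (equivalence_partition (fun x y => psame P (f x) (f y)) setT)
            [set: node m].
Proof.
apply: equivalence_partitionP => x y z _ _ _; split=> [|/eqP xy].
  exact: psamexx.
by rewrite /psame xy.
Qed.

(** The pullback of a diagram along [f]; with [nodel] or [noder] for [f] it extracts the candidate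
    tensor factors. *)
Definition ppreim k m (P : pdiag k) (f : node m -> node k) : pdiag m :=
  mkpdiag (preim_subproof P f).

Lemma psame_preim k m (P : pdiag k) (f : node m -> node k) x y :
  psame (ppreim P f) x y = psame P (f x) (f y).
Proof.
have Pp := svalP (ppreim P f).
rewrite /psame eq_pblock ?(partition_trivIset Pp) //=; last first.
  by rewrite (cover_partition Pp) inE.
rewrite pblock_equivalence_partition ?inE // => a b c _ _ _.
by split=> [|/eqP ab]; rewrite /psame ?ab.
Qed.

Lemma ptensor_mergel k m (P : pdiag k) (Q : pdiag m) a b :
  ptensor (pmerge P a b) Q = pmerge (ptensor P Q) (nodel m a) (nodel m b).
Proof.
apply: pdiag_ext => x y; rewrite psame_merge.
by case: (nodeP x) => -[{}x ->]; case: (nodeP y) => -[{}y ->];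
   rewrite !psame_tensor ?psame_merge ?andbF ?orbF.
Qed.

Lemma ptensor_merger k m (P : pdiag k) (Q : pdiag m) a b :
  ptensor P (pmerge Q a b) = pmerge (ptensor P Q) (noder k a) (noder k b).
Proof.
apply: pdiag_ext => x y; rewrite psame_merge.
by case: (nodeP x) => -[{}x ->]; case: (nodeP y) => -[{}y ->];
   rewrite !psame_tensor ?psame_merge ?andbF ?orbF.
Qed.

(* [psame (pmerge P a b)] is the least equivalence containing [psame P] and
   [(a, b)], which gives the commutation of merges below. *)
Lemma pmerge_min k (P Q : pdiag k) a b :
  psame Q a b -> subrel (psame P) (psame Q) ->
  subrel (psame (pmerge P a b)) (psame Q).
Proof.
move=> ab PQ x y; rewrite psame_merge => /or3P[/PQ // | |] /andP[/PQ xa /PQ yb].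
  by apply: psame_trans yb; apply: psame_trans ab.
by apply: psame_trans yb; apply: (psame_trans xa); rewrite psameC.
Qed.

Lemma pmergeC k (P : pdiag k) a b c d :
  pmerge (pmerge P a b) c d = pmerge (pmerge P c d) a b.
Proof.
have sub e f g h : subrel (psame (pmerge (pmerge P e f) g h))
                          (psame (pmerge (pmerge P g h) e f)).
  have le Q u v : subrel (psame Q) (psame (@pmerge k Q u v)).
    by move=> x y; rewrite psame_merge => ->.
  have new Q u v : psame (@pmerge k Q u v) u v.
    by rewrite psame_merge !psamexx orbT.
  apply: pmerge_min; first exact/le/new.
  by apply: pmerge_min => [|x y xy]; [exact: new | exact/le/le].
by apply: pdiag_ext => x y; apply/idP/idP; apply: sub.
Qed.

(** * The bullet operation *)

Lemma dbulletE k m (P : pdiag k.+1) (Q : pdiag m.+1) :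
  dbullet (mkdiag P) (mkdiag Q) = mkdiag (pmerge (ptensor P Q)
    (nodel m.+1 (inr ord_max)) (noder k.+1 (inr ord0))).
Proof. by []. Qed.

Lemma diagramP d : d = dempty \/ exists k (P : pdiag k.+1), d = mkdiag P.
Proof.
case: d => [[|k] P]; last by right; exists k, P.
by left; apply/eqP; rewrite -order_eq0.
Qed.

Lemma dempty_bullet : left_id dempty dbullet.
Proof. by case. Qed.

Lemma dbullet_empty : right_id dempty dbullet.
Proof. by move=> d; case: (diagramP d) => [-> // | [k [P ->]]]. Qed.

Lemma order_bullet d e :
  Defs.order (dbullet d e) = Defs.order d + Defs.order e.
Proof.
by case: d => [[|k] P]; case: e => [[|m] Q]; rewrite /Defs.order //= addn0.
Qed.

(** With all three diagrams non-empty, both sides are the triple tensor product with one merge at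
    each seam. Tensoring lets the inner merge move outwards, and merges commute. *)
Lemma dbulletA : associative dbullet.
Proof.
move=> d e f; case: (diagramP d) => [-> | [k [P ->]]].
  by rewrite !dempty_bullet.
case: (diagramP e) => [-> | [m [Q ->]]].
  by rewrite dempty_bullet dbullet_empty.
case: (diagramP f) => [-> | [n [R ->]]].
  by rewrite !dbullet_empty.
rewrite (dbulletE P Q) (dbulletE Q R).
(* The inner bullets have orders [m.+1 + n.+1] and [k.+1 + m.+1], successors only up to conversion,
   so [dbullet] is unfolded by conversion. *)
rewrite -[dbullet (mkdiag P) _]/(mkdiag (pmerge (ptensor P (pmerge _ _ _)) _ _)).
rewrite -[RHS]/(mkdiag (pmerge (ptensor (pmerge _ _ _) R) _ _)).
rewrite ptensor_mergel ptensor_merger pmergeC.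
have A : mkdiag (ptensor P (ptensor Q R)) = mkdiag (ptensor (ptensor P Q) R).
  exact: (dtensorA (mkdiag P) (mkdiag Q) (mkdiag R)).
by apply: pmerge_cast; rewrite ?nodeE //= ?addn0 //;
   [apply: pmerge_cast; rewrite ?nodeE //= addn0|exact: esym (addnS k m)].
Qed.

(** * Irreducibility in terms of cuts *)

Lemma irreducible_crossing d i : irreducible d -> 0 < i < Defs.order d ->
  exists x y : node (Defs.order d), idx x < i <= idx y /\ psame (tagged d) x y.
Proof.
move=> irr /andP[i0]; case: d irr => n P; rewrite /Defs.order /= => irr ltin.
have [[x y] /= xyP|nocross] := pickP (fun p : node n * node n =>
    (idx p.1 < i <= idx p.2) && psame P p.1 p.2).
  by exists x, y; apply/andP.
(* With no block across the cut at [i], the diagram is the tensor product of its restrictions to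
   both sides, each of positive order. *)
exfalso; have [m m0 nE] : exists2 m, 0 < m & n = i + m.
  by exists (n - i); rewrite ?subn_gt0 // subnKC // ltnW.
subst n; have [X [Y XY]] : exists X Y, P = ptensor X Y.
  exists (ppreim P (@nodel i m)), (ppreim P (@noder i m)).
  have cross x y : psame P (nodel m x) (noder i y) = false.
    by have := nocross (nodel m x, noder i y); rewrite /= !nodeE idx_lt leq_addr.
  apply: pdiag_ext => x y.
  by case: (nodeP x) => -[{}x ->]; case: (nodeP y) => -[{}y ->];
     rewrite !psame_tensor ?psame_preim ?cross // psameC cross.
have := Defs.irreducibleP _ irr (mkdiag X) (mkdiag Y).
rewrite /dtensor /= -XY => /(_ erefl) [] /eqP;
  rewrite -order_eq0 /Defs.order /= => /eqP E.
  by rewrite E in i0.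
by rewrite E in m0.
Qed.

Lemma tensor_crossing d e f (x y : node (Defs.order f)) : dtensor d e = f ->
  psame (tagged f) x y -> idx x < Defs.order d -> idx y < Defs.order d.
Proof.
move=> ef; subst f; case: d x y => k P; case: e => m Q x y.
rewrite /Defs.order /=.
case: (nodeP x) => -[{}x ->]; case: (nodeP y) => -[{}y ->];
  rewrite ?psame_tensor ?nodeE ?idx_lt //=.
by rewrite !ltnNge !leq_addr.
Qed.

Lemma irreducible_bullet d e : d != dempty -> e != dempty ->
  irreducible d -> irreducible e -> irreducible (dbullet d e).
Proof.
move=> /eqP d0 /eqP e0.
case: (diagramP d) => [/d0 [] | [k [P Ed]]].
case: (diagramP e) => [/e0 [] | [m [Q Ee]]].
rewrite Ed Ee {d d0 Ed e e0 Ee} => irrP irrQ; apply/Defs.irreducibleP => u v uv.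
have := order_tensor u v; rewrite uv order_bullet /Defs.order /=.
rewrite -/(Defs.order u) -/(Defs.order v) => ouv.
have [/eqP | u0] := posnP (Defs.order u); first by rewrite order_eq0 => /eqP; left.
have [/eqP | v0] := posnP (Defs.order v); first by rewrite order_eq0 => /eqP; right.
exfalso.
(* [p] and [q] are the two nodes whose blocks the bullet merges. *)
pose p := nodel m.+1 (inr ord_max : node k.+1).
pose q := noder k.+1 (inr ord0 : node m.+1).
have nocross x y : idx x < Defs.order u <= idx y ->
    psame (pmerge (ptensor P Q) p q) x y = false.
  case/andP=> xu uy; apply/negP => /(tensor_crossing uv) /(_ xu).
  by rewrite ltnNge uy.
have le x y : psame (ptensor P Q) x y -> psame (pmerge (ptensor P Q) p q) x y.
  by rewrite psame_merge => ->.
(* The cut at the order of [u] falls inside the first diagram, inside the second, or exactly at the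
   seam. *)
have [ltuk | ltku | eqku] := ltngtP (Defs.order u) k.+1.
- have [|x [y [/= xy Pxy]]] := irreducible_crossing irrP (i := Defs.order u).
    by rewrite u0.
  have := nocross (nodel m.+1 x) (nodel m.+1 y); rewrite !nodeE xy => /(_ isT).
  by rewrite le // psame_tensor.
- have [|x [y [/= xy Qxy]]] :=
      irreducible_crossing irrQ (i := Defs.order u - k.+1).
    by rewrite subn_gt0 ltku /Defs.order /=; move: ouv v0; rewrite /Defs.order; lia.
  have := nocross (noder k.+1 x) (noder k.+1 y); rewrite !nodeE.
  rewrite le ?psame_tensor // => H; suff: true = false by [].
  by apply: H; move: xy; lia.
- have := nocross p q; rewrite !nodeE /= eqku addn0 ltnSn => /(_ isT).
  by rewrite psame_merge !psamexx orbT.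
Qed.

(* Equidivisibility, which makes the monoid of diagrams free on its
   irreducibles. *)
Lemma dtensor_levi d e d' e' : dtensor d e = dtensor d' e' ->
  Defs.order d <= Defs.order d' ->
  exists x, d' = dtensor d x /\ e = dtensor x e'.
Proof.
case: d e d' e' => [k P] [n Q] [k' P'] [n' Q'] E.
rewrite /Defs.order /= => lekk'.
have [m k'E] : exists m, k' = k + m by exists (k' - k); rewrite subnKC.
subst k'; have nE : n = m + n'.
  by have := congr1 Defs.order E; rewrite /Defs.order /=; lia.
(* [X] is the part of [d'] beyond the nodes of [d]. The two products live on [k + (m + n')] and
   [(k + m) + n'], so [sE] compares them by side and index. *)
subst n; pose X := ppreim P' (@noder k m).
have sE x y x' y' : side x = side x' -> idx x = idx x' ->
    side y = side y' -> idx y = idx y' ->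
    psame (ptensor P Q) x y = psame (ptensor P' Q') x' y'.
  exact: (psame_cast E).
have P'E : P' = ptensor P X.
  apply: pdiag_ext => x y; rewrite -(psame_tensor_ll P' Q').
  case: (nodeP x) => -[{}x ->]; case: (nodeP y) => -[{}y ->].
  - by rewrite -(sE (nodel _ x) (nodel _ y)) ?nodeE // !psame_tensor.
  - by rewrite -(sE (nodel _ x) (noder _ (nodel _ y))) ?nodeE // !psame_tensor.
  - by rewrite -(sE (noder _ (nodel _ x)) (nodel _ y)) ?nodeE // !psame_tensor.
  - by rewrite !psame_tensor psame_preim.
exists (mkdiag X); split; first by rewrite P'E.
congr mkdiag; apply: pdiag_ext => x y; rewrite -(psame_tensor_rr P Q).
case: (nodeP x) => -[{}x ->]; case: (nodeP y) => -[{}y ->].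
- rewrite (sE _ _ (nodel _ (noder _ x)) (nodel _ (noder _ y))) ?nodeE //.
  by rewrite !psame_tensor psame_preim.
- rewrite (sE _ _ (nodel _ (noder _ x)) (noder _ y)) ?nodeE ?addnA //.
  by rewrite !psame_tensor.
- rewrite (sE _ _ (noder _ x) (nodel _ (noder _ y))) ?nodeE ?addnA //.
  by rewrite !psame_tensor.
- rewrite (sE _ _ (noder _ x) (noder _ y)) ?nodeE ?addnA //.
  by rewrite !psame_tensor.
Qed.

(** * Unique factorization: diagrams as words in letters *)

Definition letter d := (d != dempty) && irreducible d.

(** By equidivisibility the first letter of smaller order is a left factor of the other, and
    irreducibility makes the remaining factor empty. *)
Lemma letter_tensor_inj d e d' e' : letter d -> letter d' ->
  dtensor d e = dtensor d' e' -> d = d' /\ e = e'.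
Proof.
wlog le : d e d' e' / Defs.order d <= Defs.order d'.
  move=> H ld ld' E; have [le|/ltnW le] := leqP (Defs.order d) (Defs.order d').
    exact: H.
  by have [-> ->] := H _ _ _ _ le ld' ld (esym E).
move=> /andP[d0 _] /andP[_ irr] /dtensor_levi /(_ le) [x [d'E ->]].
have [d1 | x1] := Defs.irreducibleP _ irr _ _ (esym d'E).
  by rewrite d1 eqxx in d0.
by rewrite d'E x1 dtensor_empty dempty_tensor.
Qed.

Lemma dtensors_inj s t : all letter s -> all letter t ->
  dtensors s = dtensors t -> s = t.
Proof.
have dnil d w : letter d -> dtensor d w != dempty.
  case/andP; rewrite -order_eq0 => d0 _.
  by rewrite -order_eq0 order_tensor addn_eq0 (negPf d0).
elim: s t => [|d s IHs] [|e t] //=.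
- by move=> _ /andP[le _] E; have := dnil _ (dtensors t) le; rewrite -E eqxx.
- by move=> /andP[ld _] _ E; have := dnil _ (dtensors s) ld; rewrite E eqxx.
move=> /andP[ld ls] /andP[le lt] /(letter_tensor_inj ld le) [-> /IHs].
by move=> /(_ ls lt) ->.
Qed.

Lemma factors_letters d : all letter (factors d).
Proof. by case/andP: (factorsP d). Qed.

Lemma dtensors_factors d : dtensors (factors d) = d.
Proof. by case/andP: (factorsP d) => _ /eqP. Qed.

(** Uniqueness removes the arbitrary choice in [factors]: on words of letters it is inverse to
    [dtensors]. *)
Lemma factors_dtensors s : all letter s -> factors (dtensors s) = s.
Proof.
by move=> ls; apply: dtensors_inj; rewrite ?factors_letters ?dtensors_factors.
Qed.

Lemma factors_tensor d e : factors (dtensor d e) = factors d ++ factors e.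
Proof.
rewrite -{1}(dtensors_factors d) -{1}(dtensors_factors e) -dtensors_cat.
apply: factors_dtensors; rewrite all_cat.
by apply/andP; split; apply: factors_letters.
Qed.

Lemma letter_bullet d e : letter d -> letter e -> letter (dbullet d e).
Proof.
move=> /andP[d0 id] /andP[e0 ie]; rewrite /letter irreducible_bullet // andbT.
by rewrite -order_eq0 order_bullet addn_eq0 order_eq0 (negPf d0).
Qed.

(** * Quasi-shuffles and deconcatenation of words *)

Section QuasiShuffle.

Context (A : Type) (op : A -> A -> A).
Implicit Types (r s t w : seq A) (p q : seq A * seq A).

(** A list, so that equal words arising in different ways keep their multiplicity. The nested [fix]
    is there because a call may shorten the second word alone. *)
Fixpoint qsh r : seq A -> seq (seq A) :=
  if r is a :: r' then
    fix qsh_r s := if s is b :: s' then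
      [seq a :: w | w <- qsh r' s] ++ [seq b :: w | w <- qsh_r s']
        ++ [seq op a b :: w | w <- qsh r' s']
    else [:: r]
  else fun s => [:: s].

Fixpoint deconcat r : seq (seq A * seq A) :=
  ([::], r) ::
  if r is a :: r' then [seq (a :: p.1, p.2) | p <- deconcat r'] else [::].

Lemma qsh_nil r : qsh r [::] = [:: r].
Proof. by case: r. Qed.

Lemma all_qsh (P : pred A) r s :
  (forall a b, P a -> P b -> P (op a b)) ->
  all P r -> all P s -> all (all P) (qsh r s).
Proof.
move=> Pop; elim: r s => [|a r IHr] s /=; first by rewrite andbT.
case/andP=> Pa Pr; elim: s => [|b s IHs] /=; first by rewrite Pa Pr.
case/andP=> Pb Ps.
have sub c W : P c -> all (all P) W -> all (all P) [seq c :: w | w <- W].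
  by move=> Pc; rewrite all_map; apply: sub_all => w /= ->; rewrite Pc.
by rewrite !all_cat !sub ?IHr ?IHs ?Pop //= Pb.
Qed.

(** * Word identities with multiplicity, as equalities of sums of an arbitrary function *)

Section Sums.

Context (U : nmodType).
Implicit Types (F : seq A -> U) (G : seq A -> seq A -> U).
Local Open Scope ring_scope.

Lemma big_qsh_cons a r b s F :
  \sum_(w <- qsh (a :: r) (b :: s)) F w =
  \sum_(w <- qsh r (b :: s)) F (a :: w) + \sum_(w <- qsh (a :: r) s) F (b :: w)
  + \sum_(w <- qsh r s) F (op a b :: w).
Proof. by rewrite /= !big_cat !big_map /= addrA. Qed.

Lemma big_deconcat_cons a r G :
  \sum_(p <- deconcat (a :: r)) G p.1 p.2 =
  G [::] (a :: r) + \sum_(p <- deconcat r) G (a :: p.1) p.2.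
Proof. by rewrite big_cons big_map. Qed.

(** Both sides are sorted by the first letter of the result, which is the product of a non-empty
    subset of the heads [a], [b], [c]. Each of the seven classes is an instance of an induction
    hypothesis; [opA] identifies the letter in the class of all three. *)
Lemma big_qshA : associative op -> forall r s t F,
  \sum_(x <- qsh r s) \sum_(w <- qsh x t) F w =
  \sum_(y <- qsh s t) \sum_(w <- qsh r y) F w.
Proof.
move=> opA; elim=> [|a r IHr] s t F.
  by rewrite big_seq1; apply: eq_bigr => y _; rewrite big_seq1.
elim: s t F => [|b s IHs] t F; first by rewrite !big_seq1.
elim: t F => [|c t IHt] F.
  rewrite qsh_nil big_seq1; apply: eq_bigr => x _.
  by rewrite qsh_nil big_seq1.
have bindl x X t' F' :
    \sum_(w <- [seq x :: w | w <- X]) \sum_(w' <- qsh w (c :: t')) F' w' =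
    \sum_(w <- X) \sum_(w' <- qsh w (c :: t')) F' (x :: w')
    + \sum_(w <- [seq x :: w | w <- X]) \sum_(w' <- qsh w t') F' (c :: w')
    + \sum_(w <- X) \sum_(w' <- qsh w t') F' (op x c :: w').
  by rewrite !big_map -!big_split; apply: eq_bigr => w _ /=; rewrite big_qsh_cons.
have bindr x X r' F' :
    \sum_(w <- [seq x :: w | w <- X]) \sum_(w' <- qsh (a :: r') w) F' w' =
    \sum_(w <- [seq x :: w | w <- X]) \sum_(w' <- qsh r' w) F' (a :: w')
    + \sum_(w <- X) \sum_(w' <- qsh (a :: r') w) F' (x :: w')
    + \sum_(w <- X) \sum_(w' <- qsh r' w) F' (op a x :: w').
  by rewrite !big_map -!big_split; apply: eq_bigr => w _ /=; rewrite big_qsh_cons.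
have split x y W r' s' :
  \sum_(w <- qsh (x :: r') (y :: s')) W w =
  \sum_(w <- [seq x :: w | w <- qsh r' (y :: s')]) W w +
  \sum_(w <- [seq y :: w | w <- qsh (x :: r') s']) W w +
  \sum_(w <- [seq op x y :: w | w <- qsh r' s']) W w :> U.
  by rewrite big_qsh_cons !big_map.
rewrite !split !bindl !bindr.
have := IHt (fun w => F (c :: w)); rewrite split => Ec.
have := IHr (b :: s) (c :: t) (fun w => F (a :: w)).
rewrite [X in _ = X -> _]split => Ea.
have Eb := IHs (c :: t) (fun w => F (b :: w)).
have Eab := IHr s (c :: t) (fun w => F (op a b :: w)).
have Eac := IHr (b :: s) t (fun w => F (op a c :: w)).
have Ebc := IHs t (fun w => F (op b c :: w)).
have Eabc := IHr s t (fun w => F (op a (op b c) :: w)).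
rewrite -opA -Eabc -Ebc -Eac -Eab -Eb.
(* On the left, terms 2, 5 and 8 start with [c] and recombine into a sum over
   [qsh (a :: r) (b :: s)]; on the right, terms 1, 4 and 7 start with [a] and recombine into a sum
   over [qsh (b :: s) (c :: t)]. *)
rewrite [LHS](AC (3*3*3) (1*4*7*(2*5*8)*3*6*9))
  [RHS](AC (3*3*3) ((1*4*7)*2*3*5*6*8*9)) /=.
rewrite -Ea Ec.
by [].
Qed.

(** Both sides run over the ways to cut [r] into three consecutive pieces. *)
Lemma big_deconcatA r (G : seq A -> seq A -> seq A -> U) :
  \sum_(p <- deconcat r) \sum_(q <- deconcat p.1) G q.1 q.2 p.2 =
  \sum_(p <- deconcat r) \sum_(q <- deconcat p.2) G p.1 q.1 q.2.
Proof.
elim: r G => [|a r IHr] G; first by rewrite !big_seq1.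
rewrite (big_deconcat_cons a r (fun u v => \sum_(q <- deconcat u) G q.1 q.2 v)).
rewrite (big_deconcat_cons a r (fun u v => \sum_(q <- deconcat v) G u q.1 q.2)).
rewrite big_seq1 (big_deconcat_cons a r (G [::])) -addrA; congr (_ + _).
rewrite -(IHr (fun u => G (a :: u))) -big_split; apply: eq_bigr => p _.
by rewrite (big_deconcat_cons a p.1 (fun u v => G u v p.2)).
Qed.

(** Only the cut with empty prefix survives. This lemma and its mirror image below yield the two
    counit laws. *)
Lemma big_deconcat_nill r G : (forall a u v, G (a :: u) v = 0) ->
  \sum_(p <- deconcat r) G p.1 p.2 = G [::] r.
Proof.
move=> G0; case: r => [|a r]; first by rewrite big_seq1.
by rewrite big_deconcat_cons big1 ?addr0.
Qed.

Lemma big_deconcat_nilr r G : (forall u a v, G u (a :: v) = 0) ->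
  \sum_(p <- deconcat r) G p.1 p.2 = G r [::].
Proof.
elim: r G => [|a r IHr] G G0; first by rewrite big_seq1.
by rewrite big_deconcat_cons G0 add0r (IHr (fun u v => G (a :: u) v)).
Qed.

(** A cut of a quasi-shuffle either precedes its first letter, which corresponds to two empty
    prefixes, or keeps that letter on the left, where the recursion of [qsh] applies to the
    prefixes. *)
Lemma big_qsh_deconcat r s G :
  \sum_(w <- qsh r s) \sum_(p <- deconcat w) G p.1 p.2 =
  \sum_(p <- deconcat r) \sum_(q <- deconcat s)
    \sum_(u <- qsh p.1 q.1) \sum_(v <- qsh p.2 q.2) G u v.
Proof.
elim: r s G => [|a r IHr] s G.
  by rewrite !big_seq1; apply: eq_bigr => q _; rewrite !big_seq1.
elim: s G => [|b s IHs] G.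
  rewrite big_seq1; apply: eq_bigr => p _.
  by rewrite big_seq1 !qsh_nil !big_seq1.
(* [H] is the contribution of fixed cuts, with prefixes [u1], [v1] and suffixes [u2], [v2]; [Hc c]
   is the same with the letter [c] put in front of the left part. *)
pose H (F' : seq A -> seq A -> U) u1 u2 v1 v2 :=
  \sum_(u <- qsh u1 v1) \sum_(v <- qsh u2 v2) F' u v : U.
pose HG := H G; pose Hc c := H (fun u => G (c :: u)).
have HGcons u1 u2 v1 v2 : HG (a :: u1) u2 (b :: v1) v2 =
    Hc a u1 u2 (b :: v1) v2 + Hc b (a :: u1) u2 v1 v2 + Hc (op a b) u1 u2 v1 v2.
  exact: (big_qsh_cons a u1 b v1 (fun u => \sum_(v <- qsh u2 v2) G u v)).
have HGl u2 v1 v2 : HG [::] u2 (b :: v1) v2 = Hc b [::] u2 v1 v2.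
  by rewrite /HG /Hc /H !big_seq1.
have HGr u1 u2 v2 : HG (a :: u1) u2 [::] v2 = Hc a u1 u2 [::] v2.
  by rewrite /HG /Hc /H !qsh_nil !big_seq1.
have cut c X : \sum_(w <- X) \sum_(p <- deconcat (c :: w)) G p.1 p.2 =
    \sum_(w <- X) G [::] (c :: w)
    + \sum_(w <- X) \sum_(p <- deconcat w) G (c :: p.1) p.2.
  by rewrite -big_split; apply: eq_bigr => w _; rewrite big_deconcat_cons.
have cutl (H' : seq A -> seq A -> seq A -> seq A -> U) S :
    \sum_(p <- deconcat (a :: r)) \sum_(q <- S) H' p.1 p.2 q.1 q.2 =
    \sum_(q <- S) H' [::] (a :: r) q.1 q.2
    + \sum_(p <- deconcat r) \sum_(q <- S) H' (a :: p.1) p.2 q.1 q.2.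
  exact: (big_deconcat_cons a r (fun u v => \sum_(q <- S) H' u v q.1 q.2)).
have cutr (H' : seq A -> seq A -> seq A -> seq A -> U) S :
    \sum_(p <- S) \sum_(q <- deconcat (b :: s)) H' p.1 p.2 q.1 q.2 =
    \sum_(p <- S) H' p.1 p.2 [::] (b :: s)
    + \sum_(p <- S) \sum_(q <- deconcat s) H' p.1 p.2 (b :: q.1) q.2.
  rewrite -big_split; apply: eq_bigr => p _.
  by rewrite (big_deconcat_cons b s (H' p.1 p.2)).
rewrite big_qsh_cons !cut (IHr (b :: s) (fun u => G (a :: u))).
rewrite (IHs (fun u => G (b :: u))) (IHr s (fun u => G (op a b :: u))).
rewrite (cutr (Hc a)) (cutl (Hc b)).
rewrite [RHS](cutl HG) (big_deconcat_cons b s (HG [::] (a :: r))).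
rewrite (cutr (fun u1 => HG (a :: u1))).
have -> : HG [::] (a :: r) [::] (b :: s) =
    \sum_(w <- qsh (a :: r) (b :: s)) G [::] w by rewrite /HG /H big_seq1.
rewrite big_qsh_cons.
have -> : \sum_(q <- deconcat s) HG [::] (a :: r) (b :: q.1) q.2 =
    \sum_(q <- deconcat s) Hc b [::] (a :: r) q.1 q.2.
  by apply: eq_bigr => q _; exact: HGl.
have -> : \sum_(p <- deconcat r) HG (a :: p.1) p.2 [::] (b :: s) =
    \sum_(p <- deconcat r) Hc a p.1 p.2 [::] (b :: s).
  by apply: eq_bigr => p _; exact: HGr.
have -> : \sum_(p <- deconcat r) \sum_(q <- deconcat s)
      HG (a :: p.1) p.2 (b :: q.1) q.2 =
    \sum_(p <- deconcat r) \sum_(q <- deconcat s) Hc a p.1 p.2 (b :: q.1) q.2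
    + \sum_(p <- deconcat r) \sum_(q <- deconcat s) Hc b (a :: p.1) p.2 q.1 q.2
    + \sum_(p <- deconcat r) \sum_(q <- deconcat s) Hc (op a b) p.1 p.2 q.1 q.2.
  rewrite -!big_split; apply: eq_bigr => p _; rewrite -!big_split.
  by apply: eq_bigr => q _; exact: HGcons.
(* Both sides are now the same eight sums: three for a cut before the first letter, five for a first
   letter kept on the left. *)
by rewrite [LHS](AC ((1*2)*(1*2)*2) (1*4*7*5*2*3*6*8))
  [RHS](AC (3*1*(1*3)) (1*2*3*4*5*6*7*8)) /=.
Qed.

End Sums.

End QuasiShuffle.

Lemma mem_deconcat (A : eqType) (r : seq A) p :
  (p \in deconcat r) = (p.1 ++ p.2 == r).
Proof.
elim: r p => [|a r IHr] [[|b u] v] //=.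
- by rewrite in_cons orbF xpair_eqE.
- rewrite in_cons xpair_eqE eqxx /=; apply/orb_idr.
  by case/mapP => q _ [].
rewrite in_cons xpair_eqE /=; apply/mapP/eqP => [[q]|[-> E]].
  by rewrite IHr => /eqP <- [-> -> ->].
by exists (u, v); rewrite // IHr E.
Qed.

Lemma deconcat_uniq (A : eqType) (r : seq A) : uniq (deconcat r).
Proof.
elim: r => [|a r IHr] //=; rewrite map_inj_uniq ?IHr ?andbT.
  by apply/mapP => -[q _ []].
by move=> [u v] [u' v'] [-> ->].
Qed.

(** * Splits and shuffles as words *)

(** By unique factorization, splitting [d] as a tensor product means cutting its word of letters. *)
Lemma perm_splits d : perm_eq (enum_fset (splits d))
  [seq (dtensors p.1, dtensors p.2) | p <- deconcat (factors d)].
Proof.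
have inE p : p \in deconcat (factors d) -> all letter p.1 /\ all letter p.2.
  rewrite mem_deconcat => /eqP E; apply/andP.
  by rewrite -all_cat E; apply: factors_letters.
apply: uniq_perm.
- exact: fset_uniq.
- rewrite map_inj_in_uniq ?deconcat_uniq // => -[u v] [u' v'] /inE[/= lu lv].
  by move=> /inE[/= lu' lv'] [/(dtensors_inj lu lu') -> /(dtensors_inj lv lv') ->].
- move=> [a b]; rewrite -[LHS]/((a, b) \in splits d) in_splits /=.
  apply/eqP/mapP => [<- | [[u v]]].
    exists (factors a, factors b); first by rewrite mem_deconcat factors_tensor.
    exact: (congr2 pair (esym (dtensors_factors a)) (esym (dtensors_factors b))).
  rewrite mem_deconcat /= => /eqP uv [-> ->].
  by rewrite -dtensors_cat uv dtensors_factors.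
Qed.

(* The recursion of [qsh], keeping the two sequences padded with [dempty]
   instead of their bullets. *)
Fixpoint padded_pairs (r : seq diagram) :
    seq diagram -> seq (seq diagram * seq diagram) :=
  fix padded_r s :=
    match r, s with
    | [::], [::] => [:: ([::], [::])]
    | a :: r', [::] =>
        [seq (a :: p.1, dempty :: p.2) | p <- padded_pairs r' [::]]
    | [::], b :: s' =>
        [seq (dempty :: p.1, b :: p.2) | p <- padded_r s']
    | a :: r', b :: s' =>
        [seq (a :: p.1, dempty :: p.2) | p <- padded_pairs r' s]
        ++ [seq (dempty :: p.1, b :: p.2) | p <- padded_r s']
        ++ [seq (a :: p.1, b :: p.2) | p <- padded_pairs r' s']
    end.

(** As [dempty] is the unit of the bullet, a column with one padded entry contributes the other
    entry, and a full column the bullet letter. *)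
Lemma padded_pairs_qsh r s :
  [seq dbullets p | p <- padded_pairs r s] = qsh dbullet r s.
Proof.
have consE a b W : [seq dbullets p | p <- [seq (a :: p.1, b :: p.2) | p <- W]] =
    [seq dbullet a b :: w | w <- [seq dbullets p | p <- W]].
  by rewrite -!map_comp; apply: eq_map.
elim: r s => [|a r IHr] s.
  by elim: s => //= b s IHs; rewrite consE IHs dempty_bullet.
elim: s => [|b s IHs].
  by rewrite /= consE IHr qsh_nil /= dbullet_empty.
by rewrite /= !map_cat !consE !IHr IHs dbullet_empty dempty_bullet.
Qed.

Lemma dbullet_eq0 d e :
  (dbullet d e == dempty) = (d == dempty) && (e == dempty).
Proof. by rewrite -!order_eq0 order_bullet addn_eq0. Qed.

(** The position of [dempty] in the first column tells the branches of the recursion apart, since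
    [r] and [s] do not contain it. *)
Lemma padded_pairs_uniq r s : all (predC1 dempty) r -> all (predC1 dempty) s ->
  uniq (padded_pairs r s).
Proof.
have inj a b : injective
    (fun p : seq diagram * seq diagram => (a :: p.1, b :: p.2)).
  by move=> [u v] [u' v'] [-> ->].
elim: r s => [|a r IHr] s /=.
  by move=> _; elim: s => //= b s IHs /andP[b0 /IHs]; rewrite map_inj_uniq.
case/andP=> a0 r0; elim: s => [|b s IHs] /=; first by rewrite map_inj_uniq ?IHr.
case/andP=> b0 s0; have /= := IHs s0 => {}IHs.
rewrite !cat_uniq !map_inj_uniq ?IHr ?IHs //= ?b0 //.
rewrite andbT; apply/andP; split; apply/hasPn => p.
  rewrite mem_cat => /orP[] /mapP[q _ ->]; apply/mapP => -[q' _ [E1 E2]].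
    by rewrite E1 eqxx in a0.
  by rewrite E2 eqxx in b0.
move=> /mapP[q _ ->]; apply/mapP => -[q' _ [E1 E2]].
by rewrite E1 eqxx in a0.
Qed.

(** What one entry leaves behind once empty diagrams are deleted. *)
Definition pad (d : diagram) : seq diagram :=
  if d == dempty then [::] else [:: d].

Lemma shuffle_cons d e r s u v : (d != dempty) || (e != dempty) ->
  is_shuffle (pad d ++ r) (pad e ++ s) (d :: u, e :: v) = is_shuffle r s (u, v).
Proof.
rewrite /is_shuffle /pad /= eqSS dbullet_eq0 negb_and => de; rewrite de; move: de.
by case: (d == _); case: (e == _); rewrite /= ?eqseq_cons ?eqxx.
Qed.

Lemma padded_pairs_cons d e r s p : (d != dempty) || (e != dempty) ->
  p \in padded_pairs r s ->
  (d :: p.1, e :: p.2) \in padded_pairs (pad d ++ r) (pad e ++ s).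
Proof.
have mapE (W : seq (seq diagram * seq diagram)) : p \in W ->
    (d :: p.1, e :: p.2) \in [seq (d :: q.1, e :: q.2) | q <- W].
  by move=> pW; apply/mapP; exists p.
rewrite /pad; have [dE|d0] := eqVneq d dempty; have [eE|e0] //= := eqVneq e dempty.
- by move=> _ /mapE; rewrite dE; case: r => //= a r; rewrite !mem_cat orbCA => ->.
- by move=> _ /mapE; rewrite eE; case: s => //= b s; rewrite !mem_cat => ->.
- by move=> _ /mapE; rewrite !mem_cat => ->; rewrite !orbT.
Qed.

(** Pairs are read column by column; the condition that no bullet is empty excludes exactly the
    column with two empty entries, leaving the branches of the recursion. *)
Lemma mem_padded_pairs r s p : all (predC1 dempty) r -> all (predC1 dempty) s ->
  (p \in padded_pairs r s) = is_shuffle r s p.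
Proof.
move=> r0 s0; apply/idP/idP; last first.
  case: p => u v; elim: u v r s {r0 s0} => [|d u IH] [|e v] r s //.
    by case/and4P => _ /eqP <- /eqP <- _.
  move=> sh; have de : (d != dempty) || (e != dempty).
    by case/and4P: sh => _ _ _ /= /andP[]; rewrite dbullet_eq0 negb_and.
  have /and4P[_ /eqP rE /eqP sE _] := sh.
  have {}rE : r = pad d ++ [seq x <- u | x != dempty].
    by rewrite -rE /= /pad; case: eqVneq.
  have {}sE : s = pad e ++ [seq x <- v | x != dempty].
    by rewrite -sE /= /pad; case: eqVneq.
  by move: sh; rewrite rE sE shuffle_cons // => /IH /(padded_pairs_cons de).
have padE d : d != dempty -> pad d = [:: d] by rewrite /pad => /negPf ->.
have pad0 : pad dempty = [::] by rewrite /pad eqxx.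
have step d e t w W p' : (d != dempty) || (e != dempty) ->
    (forall q, q \in W -> is_shuffle t w q) ->
    p' \in [seq (d :: q.1, e :: q.2) | q <- W] ->
    is_shuffle (pad d ++ t) (pad e ++ w) p'.
  by move=> de H /mapP[[u v] /H sh ->]; rewrite shuffle_cons.
elim: r r0 s s0 p => [_|a r IHr /= /andP[a0 r0]].
  elim=> [_|b s IHs /= /andP[b0 s0]] p; first by rewrite inE => /eqP ->.
  have := step dempty b [::] s _ p; rewrite pad0 padE // b0 orbT.
  by apply=> // q; apply: IHs.
elim=> [_|b s IHs /= /andP[b0 s0]] p.
  have := step a dempty r [::] _ p; rewrite pad0 padE // a0.
  by apply=> // q; apply: IHr.
rewrite !mem_cat => /or3P[].
- have := step a dempty r (b :: s) _ p; rewrite pad0 padE // a0; apply=> // q.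
  by apply: IHr => //=; rewrite b0.
- have := step dempty b (a :: r) s _ p; rewrite pad0 padE // b0 orbT.
  by apply=> // q; apply: IHs.
- have := step a b r s _ p; rewrite !padE // b0 orbT.
  by apply=> // q; apply: IHr.
Qed.

Lemma letters_neq0 s : all letter s -> all (predC1 dempty) s.
Proof. by apply: sub_all => d /andP[]. Qed.

(** Duplicates are excluded among the pairs, before taking bullets: distinct pairs can have equal
    bullets and must then be counted separately. *)
Lemma perm_shuffles d e :
  perm_eq [seq dbullets p | p <- enum_fset (shuffles (factors d) (factors e))]
          (qsh dbullet (factors d) (factors e)).
Proof.
have d0 := letters_neq0 (factors_letters d).
have e0 := letters_neq0 (factors_letters e).
rewrite -padded_pairs_qsh; apply: perm_map; apply: uniq_perm.
- exact: fset_uniq.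
- exact: padded_pairs_uniq.
- by move=> p; rewrite mem_padded_pairs // -in_shuffles.
Qed.

(** * The bialgebra structure *)

Section Words.

Context (K : fieldType).
Local Open Scope ring_scope.

Lemma lin_sum (U V : lmodType K) (f : U -> V) : linear f ->
  forall I (s : seq I) F, f (\sum_(i <- s) F i) = \sum_(i <- s) f (F i).
Proof.
move=> lf I s F; have f0 : f 0 = 0.
  by rewrite -[X in f X](addNr 0) -scaleN1r lf scaleN1r addNr.
elim: s => [|i s IHs]; first by rewrite !big_nil.
by rewrite !big_cons -[X in X + _]scale1r lf scale1r IHs.
Qed.

Definition Mw (w : seq diagram) : ParQSym K := M K (dtensors w).

Lemma factors_empty : factors dempty = [::].
Proof. exact: (@factors_dtensors [::]). Qed.

(** Every diagram is the tensor product of its letters, so the vectors [Mw w] exhaust the basis. *)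
Lemma lin_ext (U : lmodType K) (f g : ParQSym K -> U) : linear f -> linear g ->
  (forall w, all letter w -> f (Mw w) = g (Mw w)) -> f =1 g.
Proof.
move=> lf lg fg u.
rewrite (lext_unique lf (fun=> erefl)) (lext_unique lg (fun=> erefl)).
apply: eq_lext => d; rewrite -[d]dtensors_factors.
exact: fg (factors_letters d).
Qed.

Lemma PQmul_bilinear : Defs.bilinear (@PQmul K).
Proof.
split=> [v | u]; first exact: lext_linear.
move=> a v v'; rewrite /PQmul -lextD; apply: eq_lext => d.
exact: lext_linear.
Qed.

Lemma PQcomul_linear : linear (@PQcomul K).
Proof. exact: lext_linear. Qed.

Lemma PQmul_words r s : all letter r -> all letter s ->
  PQmul (Mw r) (Mw s) = \sum_(w <- qsh dbullet r s) Mw w.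
Proof.
move=> lr ls; rewrite /PQmul /Mw /M !lextU /mulM.
(* [mulM] treats empty diagrams separately; this agrees with [qsh], which is a singleton when one
   word is empty. *)
have [r0|r0] := eqVneq (dtensors r) dempty.
  by rewrite -(factors_dtensors lr) r0 factors_empty big_seq1.
have [s0|s0] := eqVneq (dtensors s) dempty.
  by rewrite -(factors_dtensors ls) s0 factors_empty qsh_nil big_seq1.
rewrite -[X in qsh _ X](factors_dtensors lr).
rewrite -[X in qsh _ _ X](factors_dtensors ls).
by rewrite -(perm_big _ (perm_shuffles _ _)) big_map.
Qed.

Lemma PQcomul_words r : all letter r ->
  PQcomul (Mw r) = \sum_(p <- deconcat r) tens (Mw p.1) (Mw p.2).
Proof.
move=> lr; rewrite /PQcomul {1}/Mw /M lextU (perm_big _ (perm_splits _)) big_map.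
by rewrite (factors_dtensors lr).
Qed.

Lemma PQcounit_words r : all letter r -> PQcounit (Mw r) = (r == [::])%:R.
Proof.
move=> lr; rewrite /PQcounit /Mw /M lextU; congr ((nat_of_bool _)%:R).
apply/eqP/eqP => [r0|-> //].
by rewrite -(factors_dtensors lr) r0 factors_empty.
Qed.

Lemma tassoc_basis (X Y Z : choiceType) (x : X) (y : Y) (z : Z) :
  tassoc (tens (tens << x >> << y >>) << z >>) =
  tens << x >> (tens << y >> << z >>) :> {malg K[(X * (Y * Z))%type]}.
Proof.
rewrite (tensU K x y) (tensU K (x, y) z) (tensU K y z) (tensU K x (y, z)).
exact: lextU.
Qed.

Lemma tassoc_words r s t : tassoc (tens (tens (Mw r) (Mw s)) (Mw t)) =
  tens (Mw r) (tens (Mw s) (Mw t)).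
Proof. exact: tassoc_basis. Qed.

Lemma tscall_words (f : ParQSym K -> K) r s :
  tscall f (tens (Mw r) (Mw s)) = f (Mw r) *: Mw s.
Proof. by rewrite /tscall /Mw /M tensU lextU. Qed.

Lemma tscalr_words (f : ParQSym K -> K) r s :
  tscalr f (tens (Mw r) (Mw s)) = f (Mw s) *: Mw r.
Proof. by rewrite /tscalr /Mw /M tensU lextU. Qed.

Lemma qsh_letters r s w : all letter r -> all letter s ->
  w \in qsh dbullet r s -> all letter w.
Proof.
by move=> lr ls; have /allP := all_qsh letter_bullet lr ls; apply.
Qed.

Lemma deconcat_letters r p : all letter r -> p \in deconcat r ->
  all letter p.1 /\ all letter p.2.
Proof. by rewrite mem_deconcat => lr /eqP E; apply/andP; rewrite -all_cat E. Qed.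

(** * Associativity and unit of the product *)

Lemma PQmul_sumr u I (s : seq I) F :
  PQmul u (\sum_(i <- s) F i) = \sum_(i <- s) PQmul u (F i) :> ParQSym K.
Proof. by rewrite (lin_sum (PQmul_bilinear.2 u)). Qed.

Lemma PQmul_suml u I (s : seq I) F :
  PQmul (\sum_(i <- s) F i) u = \sum_(i <- s) PQmul (F i) u :> ParQSym K.
Proof. by rewrite (lin_sum (PQmul_bilinear.1 u)). Qed.

Lemma PQmulA : associative (@PQmul K).
Proof.
have [m1 m2] := PQmul_bilinear.
move=> u v w; move: w.
apply: lin_ext => [a x y|a x y|t lt]; [by rewrite !m2|exact: m2|].
move: v; apply: lin_ext => [a x y|a x y|s ls];
  [by rewrite m1 m2|by rewrite m2 m1|].
move: u; apply: lin_ext => [a x y|a x y|r lr]; [exact: m1|by rewrite !m1|].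
have -> : PQmul (Mw r) (PQmul (Mw s) (Mw t)) =
    \sum_(y <- qsh dbullet s t) PQmul (Mw r) (Mw y).
  by rewrite -PQmul_sumr -(PQmul_words ls lt).
have -> : PQmul (PQmul (Mw r) (Mw s)) (Mw t) =
    \sum_(x <- qsh dbullet r s) PQmul (Mw x) (Mw t).
  by rewrite -PQmul_suml -(PQmul_words lr ls).
transitivity (\sum_(y <- qsh dbullet s t) \sum_(w <- qsh dbullet r y) Mw w).
  (* [PQmul_words] requires words of letters, which membership in the quasi-shuffle list
     provides. *)
  by apply: eq_big_seq => y /(qsh_letters ls lt) ly; apply: PQmul_words.
rewrite -big_qshA; last exact: dbulletA.
apply: eq_big_seq => y /(qsh_letters lr ls) ly.
exact: esym (PQmul_words ly lt).
Qed.

Lemma PQmul1l : left_id (M K dempty) (@PQmul K).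
Proof.
apply: lin_ext => [|//|w lw]; first exact: PQmul_bilinear.2.
by rewrite (PQmul_words (r := [::])) //= big_seq1.
Qed.

Lemma PQmul1r : right_id (M K dempty) (@PQmul K).
Proof.
apply: lin_ext => [|//|w lw]; first exact: PQmul_bilinear.1.
by rewrite (PQmul_words (s := [::])) //= qsh_nil big_seq1.
Qed.

(** * Coassociativity and counit *)

Lemma tens_suml X Y (v : {malg K[Y]}) I (s : seq I) (F : I -> {malg K[X]}) :
  tens (\sum_(i <- s) F i) v = \sum_(i <- s) tens (F i) v.
Proof. exact: (lin_sum ((tens_bilinear K X Y).1 v)). Qed.

Lemma tens_sumr X Y (u : {malg K[X]}) I (s : seq I) (F : I -> {malg K[Y]}) :
  tens u (\sum_(i <- s) F i) = \sum_(i <- s) tens u (F i).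
Proof. exact: (lin_sum ((tens_bilinear K X Y).2 u)). Qed.

Lemma PQcomulA (u : ParQSym K) :
  tassoc (tmap (@PQcomul K) id (PQcomul u)) = tmap id (@PQcomul K) (PQcomul u).
Proof.
have ld := PQcomul_linear.
have lid : linear (@id (ParQSym K)) by [].
move: u; apply: lin_ext => [a x y|a x y|r lr].
- by rewrite ld /tmap lext_linear /tassoc lext_linear.
- by rewrite ld /tmap lext_linear.
(* [tmap] and [tassoc] are unfolded to [lext] so that linearity moves them inside the sum. *)
rewrite (PQcomul_words lr) /tmap !(lin_sum (lext_linear _)) -!/(tmap _ _) /tassoc.
rewrite (lin_sum (lext_linear _)) -/(tassoc _).
transitivity (\sum_(p <- deconcat r) \sum_(q <- deconcat p.1)
    tens (Mw q.1) (tens (Mw q.2) (Mw p.2))).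
  apply: eq_big_seq => p /(deconcat_letters lr) [lp _].
  rewrite -/(tmap (@PQcomul K) id _) tmap_tens // (PQcomul_words lp) tens_suml.
  rewrite (lin_sum (lext_linear _)); apply: eq_bigr => q _.
  exact: tassoc_words.
rewrite (big_deconcatA r (fun u v w => tens (Mw u) (tens (Mw v) (Mw w)))).
apply: eq_big_seq => p /(deconcat_letters lr) [_ lp].
by rewrite -/(tmap id _ _) tmap_tens // (PQcomul_words lp) tens_sumr.
Qed.

Lemma PQcounitl (u : ParQSym K) : tscall (@PQcounit K) (PQcomul u) = u.
Proof.
have ld := PQcomul_linear.
move: u; apply: lin_ext => [a x y|//|r lr].
  by rewrite ld /tscall lext_linear.
rewrite (PQcomul_words lr) /tscall (lin_sum (lext_linear _)).
transitivity (\sum_(p <- deconcat r) (p.1 == [::])%:R *: Mw p.2).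
  apply: eq_big_seq => p /(deconcat_letters lr) [lp _].
  by rewrite -/(tscall _ _) tscall_words (PQcounit_words lp).
rewrite (big_deconcat_nill r (G := fun u v => (u == [::])%:R *: Mw v)) ?scale1r //.
by move=> a v w; rewrite scale0r.
Qed.

Lemma PQcounitr (u : ParQSym K) : tscalr (@PQcounit K) (PQcomul u) = u.
Proof.
have ld := PQcomul_linear.
move: u; apply: lin_ext => [a x y|//|r lr].
  by rewrite ld /tscalr lext_linear.
rewrite (PQcomul_words lr) /tscalr (lin_sum (lext_linear _)).
transitivity (\sum_(p <- deconcat r) (p.2 == [::])%:R *: Mw p.1).
  apply: eq_big_seq => p /(deconcat_letters lr) [_ lp].
  by rewrite -/(tscalr _ _) tscalr_words (PQcounit_words lp).
rewrite (big_deconcat_nilr r (G := fun u v => (v == [::])%:R *: Mw u)) ?scale1r //.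
by move=> a v w; rewrite scale0r.
Qed.

(** * Compatibility of the product with coproduct and counit *)

Lemma tmul_bilinear X (m : {malg K[X]} -> {malg K[X]} -> {malg K[X]}) :
  Defs.bilinear (tmul m).
Proof.
split=> [v|u k v v']; first exact: lext_linear.
by rewrite /tmul -lextD; apply: eq_lext => p; exact: lext_linear.
Qed.

Lemma tmul_suml X (m : {malg K[X]} -> {malg K[X]} -> {malg K[X]}) v
    I (s : seq I) F :
  tmul m (\sum_(i <- s) F i) v = \sum_(i <- s) tmul m (F i) v.
Proof. exact: (lin_sum ((tmul_bilinear m).1 v)). Qed.

Lemma tmul_sumr X (m : {malg K[X]} -> {malg K[X]} -> {malg K[X]}) u
    I (s : seq I) F :
  tmul m u (\sum_(i <- s) F i) = \sum_(i <- s) tmul m u (F i).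
Proof. exact: (lin_sum ((tmul_bilinear m).2 u)). Qed.

Lemma PQcomulM (u v : ParQSym K) :
  PQcomul (PQmul u v) = tmul (@PQmul K) (PQcomul u) (PQcomul v).
Proof.
have [m1 m2] := PQmul_bilinear; have ld := PQcomul_linear.
have [t1 t2] := tmul_bilinear (@PQmul K).
move: v; apply: lin_ext => [a x y|a x y|s ls];
  [by rewrite m2 ld|by rewrite ld t2|].
move: u; apply: lin_ext => [a x y|a x y|r lr];
  [by rewrite m1 ld|by rewrite ld t1|].
have -> : PQcomul (PQmul (Mw r) (Mw s)) =
    \sum_(w <- qsh dbullet r s) PQcomul (Mw w).
  by rewrite -(lin_sum ld) -(PQmul_words lr ls).
have -> : tmul (@PQmul K) (PQcomul (Mw r)) (PQcomul (Mw s)) =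
    \sum_(p <- deconcat r) \sum_(q <- deconcat s)
      tmul (@PQmul K) (tens (Mw p.1) (Mw p.2)) (tens (Mw q.1) (Mw q.2)).
  transitivity (tmul (@PQmul K) (\sum_(p <- deconcat r) tens (Mw p.1) (Mw p.2))
                     (\sum_(q <- deconcat s) tens (Mw q.1) (Mw q.2))).
    by congr tmul; apply: PQcomul_words.
  rewrite tmul_suml.
  by apply: eq_bigr => p _; rewrite tmul_sumr.
transitivity (\sum_(w <- qsh dbullet r s) \sum_(p <- deconcat w)
                 tens (Mw p.1) (Mw p.2)).
  by apply: eq_big_seq => w /(qsh_letters lr ls); apply: PQcomul_words.
rewrite (big_qsh_deconcat dbullet r s (fun u v => tens (Mw u) (Mw v))).
apply: eq_big_seq => p /(deconcat_letters lr) [lp1 lp2].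
apply: eq_big_seq => q /(deconcat_letters ls) [lq1 lq2].
rewrite (tmul_tens _ _ _ _ PQmul_bilinear).
transitivity (tens (\sum_(u <- qsh dbullet p.1 q.1) Mw u)
                   (\sum_(v <- qsh dbullet p.2 q.2) Mw v)).
  by rewrite tens_suml; apply: eq_bigr => u _; rewrite tens_sumr.
by congr tens; apply: esym; apply: PQmul_words.
Qed.

Lemma PQcomul1 : PQcomul (M K dempty) = tens (M K dempty) (M K dempty).
Proof. by rewrite (PQcomul_words (r := [::])) // big_seq1. Qed.

Lemma PQcounit_linear : linear (@PQcounit K : ParQSym K -> K^o).
Proof. exact: lext_linear. Qed.

Lemma PQcounitM (u v : ParQSym K) :
  PQcounit (PQmul u v) = PQcounit u * PQcounit v.
Proof.
have [m1 m2] := PQmul_bilinear; have le := PQcounit_linear.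
(* [K^o] is the field as a module over itself, so that [lin_ext] applies to scalar-valued maps. *)
move: v; apply: (@lin_ext K^o) => [a x y|a x y|s ls].
- by rewrite m2 le.
- by rewrite le mulrDr; congr (_ + _); exact: mulrCA.
move: u; apply: (@lin_ext K^o) => [a x y|a x y|r lr].
- by rewrite m1 le.
- by rewrite le mulrDl; congr (_ + _); exact: esym (mulrA _ _ _).
transitivity ((r == [::])%:R * (s == [::])%:R : K); last first.
  by congr (_ * _); apply: esym; apply: PQcounit_words.
have -> : PQcounit (PQmul (Mw r) (Mw s)) =
    \sum_(w <- qsh dbullet r s) (w == [::])%:R.
  rewrite (PQmul_words lr ls) (lin_sum le).
  by apply: eq_big_seq => w /(qsh_letters lr ls); apply: PQcounit_words.
case: r {lr} => [|a r]; first by rewrite big_seq1 mul1r.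
case: s {ls} => [|b s]; first by rewrite qsh_nil big_seq1 mul0r.
(* Every quasi-shuffle of two non-empty words starts with a letter, so all terms vanish. *)
by rewrite big_qsh_cons !big1 ?mul0r ?addr0.
Qed.

Lemma PQcounit1 : PQcounit (M K dempty) = 1.
Proof. by rewrite (PQcounit_words (r := [::])). Qed.

End Words.

Theorem proposition3p2 (K : fieldType) :
  is_bialgebra (@PQmul K) (M K dempty) (@PQcomul K) (@PQcounit K).
Proof.
split.
- exact: PQmul_bilinear.
- exact: PQmulA.
- exact: PQmul1l.
- exact: PQmul1r.
- exact: PQcomul_linear.
- exact: PQcounit_linear.
- exact: PQcomulA.
- exact: PQcounitl.
- exact: PQcounitr.
- exact: PQcomulM.
- exact: PQcomul1.
- exact: PQcounitM.
- exact: PQcounit1.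
Qed.
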